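(* Let $\langle\mathbf A,\sim,\exists,\forall\rangle$ be an $MG_\sim$-algebra. Then: (1) $\mathbf{Con}(\langle\mathbf A,\sim,\exists,\forall\rangle)\cong\mathbf F_{mr}(\langle\mathbf A,\sim,\exists,\forall\rangle)\cong\mathbf F_r(\langle\exists\mathbf A,\sim\rangle)\cong\mathbf{Con}(\langle\exists\mathbf A,\sim\rangle)$. (2) The following are equivalent: (a) $\langle\mathbf A,\sim,\exists,\forall\rangle$ is subdirectly irreducible; (b) $\langle\mathbf A,\sim,\exists,\forall\rangle$ is simple; (c) $\langle\exists\mathbf A,\sim\rangle$ is subdirectly irreducible; (d) $\langle\exists\mathbf A,\sim\rangle$ is simple; (e) $\langle\exists\mathbf A,\sim\rangle$ is totally ordered.
   Context: A Gödel algebra is a Heyting algebra $\langle A,\vee,\wedge,\to,0,1\rangle$ satisfying $(x\to y)\vee(y\to x)\approx 1$; put $\neg x:=x\to 0$. A De Morgan algebra is a bounded distributive lattice with a unary operation $\sim$ satisfying $\sim\sim x\approx x$ and $\sim(x\wedge y)\approx \sim x\vee\sim y$. A $G_\sim$-algebra $\langle \mathbf A,\sim\rangle$ is a Gödel algebra $\mathbf A$ with a unary operation $\sim$ that makes its bounded lattice reduct a De Morgan algebra and satisfies $\neg x\le\sim x$; put $\Delta x:=\neg\sim x$. An $MG_\sim$-algebra is an algebra $\langle A,\vee,\wedge,\to,\sim,\exists,\forall,0,1\rangle$ such that $\langle \mathbf A,\sim\rangle$ is a $G_\sim$-algebra and: (M1) $\forall x\to x\approx 1$; (M2) $\forall(x\to\forall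 y)\approx\exists x\to\forall y$; (M3) $\forall(\forall x\to y)\approx\forall x\to\forall y$; (M4) $\forall(\exists x\vee y)\approx\exists x\vee\forall y$; (Q) $\forall x\approx\ \sim\exists\sim x$. In an $MG_\sim$-algebra, $\exists A=\{\exists a:a\in A\}=\forall A$ is the universe of a subalgebra $\langle\exists\mathbf A,\sim\rangle$ of the $G_\sim$-algebra $\langle\mathbf A,\sim\rangle$. A filter is a nonempty up-closed subset closed under $\wedge$. A filter $F$ of a $G_\sim$-algebra is regular if $x\in F$ implies $\Delta x\in F$; $\mathbf F_r$ denotes the lattice of regular filters. A filter $F$ of an $MG_\sim$-algebra is monadic regular if $x\in F$ implies $\Delta x\in F$ and $\forall x\in F$; $\mathbf F_{mr}$ denotes the lattice of monadic regular filters. $\mathbf{Con}$ denotes the congruence lattice. *)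

(* Defs.v *)
From HB Require Import structures.
From mathcomp Require Import all_boot all_order.
From mathcomp Require Import boolp classical_sets.

Set Implicit Arguments.
Unset Strict Implicit.
Unset Printing Implicit Defensive.

Import Order.TTheory.

Local Open Scope order_scope.
Local Open Scope classical_set_scope.

(* The sets of a closure system form a lattice: the meet of X and Y is their
   intersection, their join is the least closed set containing their union. *)

Record closure_system (T : Type) := ClosureSystem {
  is_closed : set (set T);
  is_closed_bigcap : forall G : set (set T),
    G `<=` is_closed -> is_closed (\bigcap_(X in G) X) }.

Record closed_set (T : Type) (C : closure_system T) := ClosedSet {
  closed_set_val :> set T;
  closed_setP : is_closed C closed_set_val }.

Section ClosedSetLattice.
Variables (T : Type) (C : closure_system T).
Implicit Types X Y Z : closed_set C.

Lemma closed_set_inj X Y : closed_set_val X = closed_set_val Y -> X = Y.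
Proof.
case: X Y => [X CX] [Y CY] /= eXY; rewrite eXY in CX *.
by congr ClosedSet; exact: Prop_irrelevance.
Qed.

HB.instance Definition _ := gen_eqMixin (closed_set C).
HB.instance Definition _ := gen_choiceMixin (closed_set C).

Definition closed_le X Y : bool := `[< closed_set_val X `<=` Y >].

Fact closed_le_refl : reflexive closed_le.
Proof. by move=> X; apply/asboolP. Qed.

Fact closed_le_anti : antisymmetric closed_le.
Proof.
move=> X Y /andP[/asboolP XY /asboolP YX].
by apply: closed_set_inj; apply/seteqP.
Qed.

Fact closed_le_trans : transitive closed_le.
Proof.
move=> Y X Z /asboolP XY /asboolP YZ; apply/asboolP.
exact: subset_trans YZ.
Qed.

HB.instance Definition _ := Order.Le_isPOrder.Build set_display (closed_set C)
  closed_le_refl closed_le_anti closed_le_trans.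

Fact is_closed_setI X Y : is_closed C (X `&` Y).
Proof.
have -> : X `&` Y = \bigcap_(Z in [set closed_set_val X; closed_set_val Y]) Z.
  by rewrite bigcap_setU1 bigcap_set1.
by apply: is_closed_bigcap => _ [->|->]; exact: closed_setP.
Qed.

Fact is_closed_smallest (G : set T) : is_closed C (smallest (is_closed C) G).
Proof. by apply: is_closed_bigcap => X []. Qed.

Definition closed_meet X Y : closed_set C := ClosedSet (is_closed_setI X Y).

Definition closed_join X Y : closed_set C :=
  ClosedSet (is_closed_smallest (X `|` Y)).

Fact closed_meetP X Y Z : (X <= closed_meet Y Z) = (X <= Y) && (X <= Z).
Proof.
apply/asboolP/andP; rewrite /closed_meet /= subsetI.
  by move=> [XY XZ]; split; apply/asboolP.
by move=> [/asboolP XY /asboolP XZ].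
Qed.

Fact closed_joinP X Y Z : (closed_join X Y <= Z) = (X <= Z) && (Y <= Z).
Proof.
apply/asboolP/andP => [XYZ|[/asboolP XZ /asboolP YZ]].
  have : X `|` Y `<=` Z by apply: subset_trans XYZ; exact: sub_gen_smallest.
  by rewrite subUset => -[XZ YZ]; split; apply/asboolP.
by apply: smallest_sub; [exact: closed_setP|rewrite subUset].
Qed.

HB.instance Definition _ := Order.POrder_MeetJoin_isLattice.Build set_display
  (closed_set C) closed_meetP closed_joinP.

End ClosedSetLattice.

Definition lattice_isomorphic (d1 d2 : Order.disp_t)
    (L : latticeType d1) (M : latticeType d2) : Prop :=
  exists f : L -> M,
    [/\ bijective f, Order.meet_morphism f & Order.join_morphism f].

Record signature := Signature {
  symbol : Type;
  arity : symbol -> nat }.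

Record algebra (S : signature) := Algebra {
  carrier :> Type;
  op : forall f : symbol S, ('I_(arity f) -> carrier) -> carrier }.

Arguments op {S} _ _ _.

Section UniversalAlgebra.
Variable S : signature.

Definition homomorphism (A B : algebra S) (h : A -> B) : Prop :=
  forall (f : symbol S) (u : 'I_(arity f) -> A),
    h (op A f u) = op B f (h \o u).

Definition isomorphism (A B : algebra S) (h : A -> B) : Prop :=
  homomorphism h /\ bijective h.

Definition product_algebra (I : Type) (B : I -> algebra S) : algebra S :=
  @Algebra S (forall i, B i) (fun f u i => op (B i) f (fun k => u k i)).

Definition subdirect_embedding (A : algebra S) (I : Type) (B : I -> algebra S)
    (h : A -> product_algebra B) : Prop :=
  [/\ homomorphism h, injective h & forall i (b : B i), exists a, h a i = b].

(* The index set of a subdirect representation is nonempty, so one-element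
   algebras are subdirectly irreducible. *)
Definition subdirectly_irreducible (A : algebra S) : Prop :=
  forall (I : Type) (B : I -> algebra S) (h : A -> product_algebra B),
    inhabited I -> subdirect_embedding h ->
    exists i, isomorphism (fun a => h a i).

Section Congruences.
Variable A : algebra S.

Definition congruence (R : set (A * A)) : Prop :=
  [/\ forall x, R (x, x),
      forall x y, R (x, y) -> R (y, x),
      forall x y z, R (x, y) -> R (y, z) -> R (x, z) &
      forall (f : symbol S) (u v : 'I_(arity f) -> A),
        (forall i, R (u i, v i)) -> R (op A f u, op A f v)].

Fact congruence_bigcap (G : set (set (A * A))) :
  G `<=` congruence -> congruence (\bigcap_(R in G) R).
Proof.
move=> GC; split.
- by move=> x R /GC[].
- by move=> x y xy R GR; have [_ sR _ _] := GC _ GR; exact: sR (xy _ GR).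
- move=> x y z xy yz R GR; have [_ _ tR _] := GC _ GR.
  exact: tR (xy _ GR) (yz _ GR).
- move=> f u v uv R GR; have [_ _ _ cR] := GC _ GR.
  by apply: cR => i; exact: uv.
Qed.

Definition Con : closure_system (A * A) := ClosureSystem congruence_bigcap.

(* One-element algebras are simple: their two trivial congruences coincide. *)
Definition simple : Prop :=
  forall R : closed_set Con,
    R = [set xy | xy.1 = xy.2] :> set (A * A) \/ R = setT :> set (A * A).

End Congruences.
End UniversalAlgebra.

Local Close Scope classical_set_scope.

HB.mixin Record isHeyting d T of Order.TBDistrLattice d T := {
  himp : T -> T -> T;
  le_himp : forall x y z : T, (x <= himp y z) = (x `&` y <= z) }.

#[short(type="heytingType")]
HB.structure Definition Heyting d :=
  {T of isHeyting d T & Order.TBDistrLattice d T}.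

Definition hneg d (T : heytingType d) (x : T) : T := himp x \bot.

HB.mixin Record Heyting_isGoedel d T of Heyting d T := {
  himp_prelinear : forall x y : T, himp x y `|` himp y x = \top }.

#[short(type="goedelType")]
HB.structure Definition Goedel d := {T of Heyting_isGoedel d T & Heyting d T}.

HB.mixin Record isDeMorgan d T of Order.TBDistrLattice d T := {
  sim : T -> T;
  simK : forall x : T, sim (sim x) = x;
  simI : forall x y : T, sim (x `&` y) = sim x `|` sim y }.

#[short(type="deMorganType")]
HB.structure Definition DeMorgan d :=
  {T of isDeMorgan d T & Order.TBDistrLattice d T}.

HB.mixin Record Goedel_DeMorgan_isGsim d T of Goedel d T & DeMorgan d T := {
  hneg_le_sim : forall x : T, hneg x <= sim x }.

#[short(type="gsimType")]
HB.structure Definition Gsim d :=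
  {T of Goedel_DeMorgan_isGsim d T & Goedel d T & DeMorgan d T}.

Definition delta d (T : gsimType d) (x : T) : T := hneg (sim x).

HB.mixin Record Gsim_isMGsim d T of Gsim d T := {
  qex : T -> T;
  qall : T -> T;
  axM1 : forall x : T, himp (qall x) x = \top;
  axM2 : forall x y : T, qall (himp x (qall y)) = himp (qex x) (qall y);
  axM3 : forall x y : T, qall (himp (qall x) y) = himp (qall x) (qall y);
  axM4 : forall x y : T, qall (qex x `|` y) = qex x `|` qall y;
  axQ : forall x : T, qall x = sim (qex (sim x)) }.

#[short(type="mgsimType")]
HB.structure Definition MGsim d := {T of Gsim_isMGsim d T & Gsim d T}.

Arguments qex {d s} _.
Arguments qall {d s} _.

Section ExistsClosed.
Variables (d : Order.disp_t) (A : mgsimType d).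
Implicit Types x y z : A.

Lemma himp_eq1 x y : (himp x y == \top) = (x <= y).
Proof. by rewrite -le1x le_himp meet1x. Qed.

Lemma qall_le x : qall x <= x.
Proof. by rewrite -himp_eq1 axM1. Qed.

Lemma qall1 : qall (\top : A) = \top.
Proof.
have := axM3 (\bot : A) (qall \bot).
have b0 : qall (\bot : A) = \bot by apply/eqP; rewrite -lex0 qall_le.
have /eqP e : himp (\bot : A) \bot == \top by rewrite himp_eq1.
by rewrite !b0 e.
Qed.

Lemma le_qall x y : (x <= qall y) = (qex x <= qall y).
Proof.
rewrite -!himp_eq1 -axM2; apply/eqP/eqP => [->|e]; first exact: qall1.
by apply/eqP; rewrite -le1x -e qall_le.
Qed.

Lemma qall_qex x : qall (qex x) = qex x.
Proof.
have q0 : qall (\bot : A) = \bot by apply/eqP; rewrite -lex0 qall_le.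
by have := axM4 x (\bot : A); rewrite q0 !joinx0.
Qed.

Lemma qex_qall x : qex (qall x) = qall x.
Proof.
apply/eqP; rewrite eq_le -le_qall lexx /=.
by rewrite -(qall_qex (qall x)) le_qall qall_qex.
Qed.

Lemma range_qexP x : reflect (qex x = x) (x \in range (@qex d A)).
Proof.
apply: (iffP idP); rewrite inE; last by exists x.
by case=> y _ <-; rewrite -(qall_qex y) qex_qall.
Qed.

Lemma mem_qall x : qall x \in range (@qex d A).
Proof. by apply/range_qexP; rewrite qex_qall. Qed.

Fact range_qex_meet x y : x \in range (@qex d A) ->
  y \in range (@qex d A) -> x `&` y \in range (@qex d A).
Proof.
move=> /range_qexP ex /range_qexP ey; apply/range_qexP/eqP.
rewrite eq_le lexI; apply/andP; split.
  rewrite -{2}ex -(qall_qex x) -le_qall qall_qex ex leIl /=.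
  by rewrite -{2}ey -(qall_qex y) -le_qall qall_qex ey leIr.
by rewrite -(qall_qex (x `&` y)) le_qall qall_qex.
Qed.

Fact range_qex_join x y : x \in range (@qex d A) ->
  y \in range (@qex d A) -> x `|` y \in range (@qex d A).
Proof.
move=> /range_qexP ex /range_qexP ey.
by rewrite -ex -ey -(qall_qex y) -axM4 mem_qall.
Qed.

Fact range_qex_bot : (\bot : A) \in range (@qex d A).
Proof.
suff <- : qall (\bot : A) = \bot by exact: mem_qall.
by apply/eqP; rewrite -lex0 qall_le.
Qed.

Fact range_qex_top : (\top : A) \in range (@qex d A).
Proof. by rewrite -qall1 mem_qall. Qed.

Fact range_qex_himp x y : x \in range (@qex d A) ->
  y \in range (@qex d A) -> himp x y \in range (@qex d A).
Proof.
move=> /range_qexP ex /range_qexP ey.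
by rewrite -ex -ey -(qall_qex y) -axM2 mem_qall.
Qed.

Fact range_qex_sim x : x \in range (@qex d A) -> sim x \in range (@qex d A).
Proof.
by move=> /range_qexP ex; rewrite -ex -{1}(simK x) -axQ mem_qall.
Qed.

End ExistsClosed.

Record exists_alg d (A : mgsimType d) := ExistsAlg {
  exists_val :> A;
  exists_valP : exists_val \in range (@qex d A) }.

Section ExistsAlgebra.
Variables (d : Order.disp_t) (A : mgsimType d).
Local Notation B := (exists_alg A).
Implicit Types x y z : B.

HB.instance Definition _ := [isSub for @exists_val d A].
HB.instance Definition _ := [Choice of B by <:].
HB.instance Definition _ := Order.SubChoice_isTBSubLattice.Build d A
  (fun a : A => a \in range (@qex d A)) d B (@range_qex_meet d A)
  (@range_qex_join d A) (@range_qex_bot d A) (@range_qex_top d A).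

Lemma exists_val_inj : injective (@exists_val d A).
Proof. exact: val_inj. Qed.

Lemma exists_valI x y : exists_val (x `&` y) = exists_val x `&` exists_val y.
Proof. by []. Qed.

Lemma exists_valU x y : exists_val (x `|` y) = exists_val x `|` exists_val y.
Proof. by []. Qed.

Lemma exists_val0 : exists_val (\bot : B) = \bot.
Proof. by []. Qed.

Lemma exists_val1 : exists_val (\top : B) = \top.
Proof. by []. Qed.

Lemma exists_val_le x y : (exists_val x <= exists_val y) = (x <= y).
Proof. by []. Qed.

Fact exists_meetUl : @left_distributive B B Order.meet Order.join.
Proof.
move=> x y z; apply: exists_val_inj.
by rewrite !(exists_valI, exists_valU) meetUl.
Qed.

HB.instance Definition _ :=
  Order.Lattice_Meet_isDistrLattice.Build d B exists_meetUl.

Definition exists_himp x y : B :=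
  ExistsAlg (range_qex_himp (exists_valP x) (exists_valP y)).

Definition exists_sim x : B := ExistsAlg (range_qex_sim (exists_valP x)).

Fact exists_le_himp x y z : (x <= exists_himp y z) = (x `&` y <= z).
Proof. by rewrite -!exists_val_le exists_valI -le_himp. Qed.

HB.instance Definition _ := isHeyting.Build d B exists_le_himp.

Fact exists_himp_prelinear x y : himp x y `|` himp y x = \top.
Proof.
apply: exists_val_inj; rewrite exists_valU exists_val1.
exact: himp_prelinear.
Qed.

HB.instance Definition _ := Heyting_isGoedel.Build d B exists_himp_prelinear.

Fact exists_simK x : exists_sim (exists_sim x) = x.
Proof. by apply: exists_val_inj; rewrite /= simK. Qed.

Fact exists_simI x y : exists_sim (x `&` y) = exists_sim x `|` exists_sim y.
Proof.
by apply: exists_val_inj; rewrite exists_valU; exact: simI.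
Qed.

HB.instance Definition _ := isDeMorgan.Build d B exists_simK exists_simI.

Fact exists_hneg_le_sim x : hneg x <= sim x.
Proof. by rewrite -exists_val_le; exact: hneg_le_sim. Qed.

HB.instance Definition _ := Goedel_DeMorgan_isGsim.Build d B exists_hneg_le_sim.

End ExistsAlgebra.

Definition lattice_filter d (T : tbLatticeType d) (F : set T) : Prop :=
  [/\ (F !=set0)%classic, forall x y, x <= y -> F x -> F y &
      forall x y, F x -> F y -> F (x `&` y)].

Lemma filter_top d (T : tbLatticeType d) (F : set T) :
  lattice_filter F -> F \top.
Proof. by case=> -[x Fx] upF _; apply: upF Fx; exact: lex1. Qed.

Lemma filter_bigcap d (T : tbLatticeType d) (G : set (set T)) :
  (G `<=` @lattice_filter d T)%classic -> lattice_filter (\bigcap_(F in G) F)%classic.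
Proof.
move=> GF; split.
- by exists \top => F /GF; exact: filter_top.
- move=> x y xy Fx F GF'; have [_ upF _] := GF _ GF'.
  exact: upF xy (Fx _ GF').
- move=> x y Fx Fy F GF'; have [_ _ meetF] := GF _ GF'.
  exact: meetF (Fx _ GF') (Fy _ GF').
Qed.

Definition regular_filter d (T : gsimType d) (F : set T) : Prop :=
  lattice_filter F /\ forall x, F x -> F (delta x).

Fact regular_filter_bigcap d (T : gsimType d) (G : set (set T)) :
  (G `<=` @regular_filter d T)%classic -> regular_filter (\bigcap_(F in G) F)%classic.
Proof.
move=> GF; split; first by apply: filter_bigcap => F /GF[].
by move=> x Fx F GF'; have [_ dF] := GF _ GF'; exact: dF (Fx _ GF').
Qed.

Definition regular_filters d (T : gsimType d) : closure_system T :=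
  ClosureSystem (@regular_filter_bigcap d T).

Definition monadic_regular_filter d (T : mgsimType d) (F : set T) : Prop :=
  lattice_filter F /\ forall x, F x -> F (delta x) /\ F (qall x).

Fact monadic_regular_filter_bigcap d (T : mgsimType d) (G : set (set T)) :
  (G `<=` @monadic_regular_filter d T)%classic ->
  monadic_regular_filter (\bigcap_(F in G) F)%classic.
Proof.
move=> GF; split; first by apply: filter_bigcap => F /GF[].
move=> x Fx; split => F GF'; have [_ dqF] := GF _ GF'.
  by have [] := dqF _ (Fx _ GF').
by have [] := dqF _ (Fx _ GF').
Qed.

Definition monadic_regular_filters d (T : mgsimType d) : closure_system T :=
  ClosureSystem (@monadic_regular_filter_bigcap d T).

Inductive gsim_symbol := Sjoin | Smeet | Simp | Ssim | Sbot | Stop.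

Definition gsim_arity (f : gsim_symbol) : nat :=
  match f with
  | Sjoin | Smeet | Simp => 2
  | Ssim => 1
  | Sbot | Stop => 0
  end.

Definition gsim_signature := Signature gsim_arity.

Definition gsim_op d (T : gsimType d) (f : gsim_symbol) :
    ('I_(gsim_arity f) -> T) -> T :=
  match f return ('I_(gsim_arity f) -> T) -> T with
  | Sjoin => fun u => u ord0 `|` u ord_max
  | Smeet => fun u => u ord0 `&` u ord_max
  | Simp => fun u => himp (u ord0) (u ord_max)
  | Ssim => fun u => sim (u ord0)
  | Sbot => fun=> \bot
  | Stop => fun=> \top
  end.

Definition gsim_algebra d (T : gsimType d) : algebra gsim_signature :=
  @Algebra gsim_signature T (@gsim_op d T).

Inductive mgsim_symbol := Sgsim of gsim_symbol | Sex | Sall.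

Definition mgsim_arity (f : mgsim_symbol) : nat :=
  match f with
  | Sgsim g => gsim_arity g
  | Sex | Sall => 1
  end.

Definition mgsim_signature := Signature mgsim_arity.

Definition mgsim_op d (T : mgsimType d) (f : mgsim_symbol) :
    ('I_(mgsim_arity f) -> T) -> T :=
  match f return ('I_(mgsim_arity f) -> T) -> T with
  | Sgsim g => @gsim_op d T g
  | Sex => fun u => qex (u ord0)
  | Sall => fun u => qall (u ord0)
  end.

Definition mgsim_algebra d (T : mgsimType d) : algebra mgsim_signature :=
  @Algebra mgsim_signature T (@mgsim_op d T).

(* Main.v *)
(* A congruence is determined by the class of 1, and x, y are related exactly
   when x -> y and y -> x lie in that class; the classes of 1 that arise are the
   (monadic) regular filters.  A monadic regular filter F is recovered from its
   trace on the subalgebra of quantified elements, as x is in F iff (forall x)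
   is.  Every element Delta x is Boolean and fixed by Delta, so in a chain
   Delta sends each x <> 1 to 0 and all regular filters are trivial.
   Conversely Delta (x -> y) and Delta (y -> x) have join 1, so the congruences
   of the two principal filters they generate intersect in the identity, and
   subdirect irreducibility makes one of them 1, i.e. x, y comparable. *)
Require Import Defs.
From HB Require Import structures.
From mathcomp Require Import all_boot all_order.
From mathcomp Require Import boolp classical_sets.

Set Implicit Arguments.
Unset Strict Implicit.
Unset Printing Implicit Defensive.

Import Order.TTheory.

Local Open Scope order_scope.

(** * Isomorphisms between lattices of closed sets *)

(** Mutually inverse monotone maps are adjoint to each other on both sides, and adjointness gives
    the hard halves of the preservation of meets and joins. *)
Lemma closed_set_lattice_isomorphic (T U : Type) (C : closure_system T)
    (D : closure_system U) (f : set T -> set U) (g : set U -> set T) :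
  (forall X, is_closed C X -> is_closed D (f X)) ->
  (forall Y, is_closed D Y -> is_closed C (g Y)) ->
  (forall X, is_closed C X -> g (f X) = X) ->
  (forall Y, is_closed D Y -> f (g Y) = Y) ->
  {homo f : X Y / (X `<=` Y)%classic} -> {homo g : X Y / (X `<=` Y)%classic} ->
  lattice_isomorphic (closed_set C) (closed_set D).
Proof.
move=> fcl gcl fK gK fmono gmono.
pose F (X : closed_set C) : closed_set D := ClosedSet (fcl X (closed_setP X)).
pose G (Y : closed_set D) : closed_set C := ClosedSet (gcl Y (closed_setP Y)).
have FK : cancel F G by move=> X; apply/closed_set_inj/fK/closed_setP.
have GK : cancel G F by move=> Y; apply/closed_set_inj/gK/closed_setP.
have Fmono : {homo F : X Y / X <= Y}.
  by move=> X Y /asboolP XY; apply/asboolP/fmono.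
have Gmono : {homo G : X Y / X <= Y}.
  by move=> X Y /asboolP XY; apply/asboolP/gmono.
have FG X Y : (F X <= Y) = (X <= G Y).
  by apply/idP/idP => [/Gmono|/Fmono]; rewrite ?FK ?GK.
have GF X Y : (Y <= F X) = (G Y <= X).
  by apply/idP/idP => [/Gmono|/Fmono]; rewrite ?FK ?GK.
exists F; split; first by exists G.
- move=> X Y; apply/le_anti; rewrite lexI !Fmono ?leIl ?leIr //=.
  by rewrite GF lexI -!GF leIl leIr.
- move=> X Y; apply/le_anti; rewrite leUx !Fmono ?leUl ?leUr ?andbT //=.
  by rewrite FG leUx -!FG leUl leUr.
Qed.

(** * Quotients by a congruence *)

Section QuotientAlgebra.
Variables (S : signature) (A : algebra S) (R : set (A * A)).
Hypothesis RC : congruence R.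

Definition congruence_class : Type :=
  {X : set A | exists a, X = [set b | R (a, b)]%classic}.

Lemma congruence_class_inj (X Y : congruence_class) : sval X = sval Y -> X = Y.
Proof. by case: X Y => [X PX] [Y PY] /= eXY; exact: eq_exist. Qed.

Definition class_of (a : A) : congruence_class :=
  exist _ _ (ex_intro _ a erefl).

Definition class_repr (X : congruence_class) : A := projT1 (cid (svalP X)).

Lemma class_reprK X : class_of (class_repr X) = X.
Proof.
by apply: congruence_class_inj; rewrite /= /class_repr; case: cid => a /= ->.
Qed.

Lemma class_ofP a b : class_of a = class_of b <-> R (a, b).
Proof.
have [rR sR tR _] := RC; split=> [/(congr1 sval)/= e|ab].
  by have : [set c | R (b, c)]%classic b by []; rewrite -e.
apply: congruence_class_inj; apply/seteqP; split=> c /= h.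
  exact: tR (sR _ _ ab) h.
exact: tR ab h.
Qed.

(** Operations act on chosen representatives, so the definition carries no compatibility proof;
    compatibility enters when [class_of] is shown to be a homomorphism. *)
Definition quotient_algebra : algebra S :=
  @Algebra S congruence_class
    (fun f u => class_of (op A f (class_repr \o u))).

Lemma class_of_homomorphism : @homomorphism S A quotient_algebra class_of.
Proof.
move=> f u; apply/class_ofP; have [_ sR _ cR] := RC.
by apply: cR => i; apply/class_ofP; rewrite /= class_reprK.
Qed.

End QuotientAlgebra.

(** * Simplicity and subdirect irreducibility *)

Section SubdirectIrreducibility.
Variables (S : signature) (A : algebra S).

(** The kernel of each projection is a congruence, hence the identity or everything. *)
Lemma simple_subdirectly_irreducible : simple A -> subdirectly_irreducible A.
Proof.
move=> sA I B h [i0] [hh hinj hsurj].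
(* Each projection of a subdirect embedding is already onto. *)
suff [i inji] : exists i, injective (fun a => h a i).
  exists i; split; first by move=> f u; rewrite hh.
  have gP b : {a | h a i = b} by apply: cid; exact: hsurj.
  exists (fun b => sval (gP b)) => [a|b]; last exact: (svalP (gP b)).
  by apply: inji; exact: (svalP (gP (h a i))).
pose ker i : set (A * A) := [set xy | h xy.1 i = h xy.2 i]%classic.
have kerC i : is_closed (Con A) (ker i).
  split=> //= [x y z|f u v uv]; first by rewrite /ker /= => ->.
  rewrite /ker /= !hh /=; congr (op _ f _); apply/funext => k.
  exact: uv.
have [[i inji]|nninj] := pselect (exists i, injective (fun a => h a i)).
  by exists i.
(* With no injective projection, every kernel is everything; as [h] is injective, [A] has at most
   one element and any index will do. *)
exists i0 => x y _; apply: hinj; apply: functional_extensionality_dep => i.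
case: (sA (ClosedSet (kerC i))) => /= ek; last first.
  by have : ker i (x, y) by rewrite ek.
case: nninj; exists i => a b ab.
have : ker i (a, b) by [].
by rewrite ek.
Qed.

(* The two congruences give a subdirect embedding into a product indexed by
   [bool]. *)
Lemma subdirectly_irreducible_meet (R1 R2 : set (A * A)) :
  subdirectly_irreducible A -> congruence R1 -> congruence R2 ->
  (forall x y, R1 (x, y) -> R2 (x, y) -> x = y) ->
  (forall x y, R1 (x, y) -> x = y) \/ (forall x y, R2 (x, y) -> x = y).
Proof.
move=> siA C1 C2 R12.
pose R (b : bool) := if b then R1 else R2.
have RC b : congruence (R b) by case: b.
pose h (a : A) : product_algebra (fun b => quotient_algebra (R b)) :=
  fun b => class_of (R b) a.
have [||i [_ /bij_inj inji]] := siA bool _ h; first by constructor; exact: true.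
  split=> [f u|x y hxy|b X].
  - apply: functional_extensionality_dep => b.
    exact: (class_of_homomorphism (RC b)).
  - apply: R12.
      by apply/(class_ofP (RC true)); exact: (congr1 (fun k => k true) hxy).
    by apply/(class_ofP (RC false)); exact: (congr1 (fun k => k false) hxy).
  - by exists (class_repr X); exact: class_reprK.
have inj x y : R i (x, y) -> x = y.
  by move=> Rxy; apply: inji; apply/(class_ofP (RC i)).
by case: i inj {inji} => inj; [left|right].
Qed.

End SubdirectIrreducibility.

(** * Negations and [delta] in G~-algebras *)

Section Gsim.
Variables (d : Order.disp_t) (T : gsimType d).
Implicit Types (x y z b c : T) (F : set T).

Lemma himp_top x y : himp x y = \top <-> x <= y.
Proof. by rewrite -[x in x <= y]meet1x -le_himp le1x; split=> /eqP. Qed.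

Lemma himp_refl x : himp x x = \top.
Proof. exact/himp_top. Qed.

Lemma meet_himp x y : x `&` himp x y = x `&` y.
Proof.
apply/le_anti; rewrite !lexI !leIl /= meetC -le_himp lexx /=.
by rewrite le_himp; apply: leIxl; exact: leIr.
Qed.

Lemma le_sim x y : x <= y -> sim y <= sim x.
Proof. by move=> /meet_idPl <-; rewrite simI leUr. Qed.

Lemma sim0 : sim (\bot : T) = \top.
Proof. by apply/eqP; rewrite -le1x -(simK \top); apply: le_sim; exact: le0x. Qed.

Lemma sim1 : sim (\top : T) = \bot.
Proof. by rewrite -sim0 simK. Qed.

Lemma simU x y : sim (x `|` y) = sim x `&` sim y.
Proof. by rewrite -[RHS]simK simI !simK. Qed.

Lemma meet_hneg x : x `&` hneg x = \bot.
Proof. by rewrite meet_himp meetx0. Qed.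

Lemma le_hneg x y : x <= y -> hneg y <= hneg x.
Proof.
move=> xy; rewrite le_himp; apply: le_trans (leI2 (lexx _) xy) _.
by rewrite meetC meet_hneg.
Qed.

Lemma hneg_eq1 x : hneg x = \top -> x = \bot.
Proof. by move=> /himp_top; rewrite lex0 => /eqP. Qed.

(** Prelinearity splits the hard inequality: below [himp x y] the meet of [x] and [y] may be
    replaced by [x], below [himp y x] by [y]. *)
Lemma hnegI x y : hneg (x `&` y) = hneg x `|` hneg y.
Proof.
apply/le_anti; rewrite leUx !le_hneg ?leIl ?leIr ?andbT //.
rewrite -[hneg (x `&` y)]meetx1 -(himp_prelinear x y) meetUr leUx.
apply/andP; split; [apply: lexUl|apply: lexUr]; rewrite le_himp.
  rewrite -meetA [himp x y `&` x]meetC meet_himp meetC.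
  by rewrite meet_hneg.
by rewrite -meetA [himp y x `&` y]meetC meet_himp [y `&` x]meetC meetC meet_hneg.
Qed.

Lemma hneg_stone x : hneg x `|` hneg (hneg x) = \top.
Proof. by rewrite -hnegI meet_hneg /hneg himp_refl. Qed.

Lemma delta_le x : delta x <= x.
Proof. by rewrite -[leRHS]simK hneg_le_sim. Qed.

Lemma le_delta x y : x <= y -> delta x <= delta y.
Proof. by move=> xy; apply/le_hneg/le_sim. Qed.

Lemma delta1 : delta (\top : T) = \top.
Proof. by rewrite /delta sim1; exact: himp_refl. Qed.

(** Carries prelinearity over to the elements [delta (himp x y)]. *)
Lemma deltaU x y : delta (x `|` y) = delta x `|` delta y.
Proof. by rewrite /delta simU hnegI. Qed.

(** Applying [sim] to Stone's identity for [sim x] shows that [sim (delta x)] and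
    [sim (hneg (delta x))] meet in 0, and the latter lies above [hneg (hneg (delta x))], hence above
    [delta x]. *)
Lemma sim_delta x : sim (delta x) = hneg (delta x).
Proof.
apply/le_anti; rewrite hneg_le_sim andbT le_himp -sim1.
rewrite -(hneg_stone (sim x)) simU leI2 //.
apply: le_trans (hneg_le_sim _).
by rewrite le_himp meet_hneg.
Qed.

Lemma delta_idem x : delta (delta x) = delta x.
Proof.
apply/le_anti; rewrite delta_le /= {2}/delta sim_delta.
by rewrite le_himp meet_hneg.
Qed.

(** Applying [sim] to the inequality expressing that [b] is below [himp x y] leaves a joinand
    [sim b], which equals [hneg b] and vanishes on meeting with [b]. *)
Lemma delta_himp_sim x y : delta (himp x y) <= himp (sim y) (sim x).
Proof.
set b := delta _; rewrite le_himp.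
have /le_sim : b `&` x <= y by rewrite -le_himp delta_le.
rewrite simI sim_delta => h.
apply: le_trans (leI2 (lexx b) h) _.
by rewrite meetUr meet_hneg join0x leIr.
Qed.

(** In a chain, the larger of [delta x] and [hneg (delta x)] equals their join, which is 1 by
    Stone's identity. *)
Lemma delta_total x : total (fun x y : T => x <= y) ->
  x = \top \/ delta x = \bot.
Proof.
move=> tot; have := hneg_stone (sim x); rewrite -/(delta x).
case/orP: (tot (delta x) (hneg (delta x))) => le_d e.
  by right; apply/hneg_eq1/eqP; rewrite -le1x -e leUx le_d lexx.
left; apply/eqP; rewrite -le1x -e; apply: le_trans (delta_le x).
by rewrite leUx lexx le_d.
Qed.

Lemma lattice_filter_up b : lattice_filter [set x | b <= x]%classic.
Proof.
split=> [|x y xy bx|x y bx by_]; first by exists b => /=.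
  exact: le_trans xy.
by rewrite /= lexI bx.
Qed.

(** * Regular filters and congruences *)

Definition filter_rel F : set (T * T) :=
  [set xy | F (himp xy.1 xy.2) /\ F (himp xy.2 xy.1)]%classic.

Section FilterRelation.
Variable F : set T.
Hypothesis LF : lattice_filter F.

(** Turns the compatibility proofs below into lattice inequalities, with witnesses combined by
    meets. *)
Lemma filter_himpP x y : F (himp x y) <-> exists2 c, F c & c `&` x <= y.
Proof.
have [_ upF _] := LF; split=> [Fxy|[c Fc]]; last by rewrite -le_himp => /upF; apply.
by exists (himp x y); rewrite // -le_himp.
Qed.

Lemma filter_himp_refl x : F (himp x x).
Proof. by rewrite himp_refl; exact: filter_top. Qed.

Lemma filter_himp_trans y x z : F (himp x y) -> F (himp y z) -> F (himp x z).
Proof.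
have [_ _ meetF] := LF.
move=> /filter_himpP[c Fc cxy] /filter_himpP[e Fe eyz]; apply/filter_himpP.
exists (e `&` c); first exact: meetF.
by rewrite -meetA (le_trans _ eyz) // leI2.
Qed.

Lemma filter_himpI x y x' y' : F (himp x y) -> F (himp x' y') ->
  F (himp (x `&` x') (y `&` y')).
Proof.
have [_ _ meetF] := LF.
move=> /filter_himpP[c Fc cxy] /filter_himpP[e Fe exy]; apply/filter_himpP.
by exists (c `&` e); [exact: meetF|rewrite meetACA leI2].
Qed.

Lemma filter_himpU x y x' y' : F (himp x y) -> F (himp x' y') ->
  F (himp (x `|` x') (y `|` y')).
Proof.
have [_ _ meetF] := LF.
move=> /filter_himpP[c Fc cxy] /filter_himpP[e Fe exy]; apply/filter_himpP.
exists (c `&` e); first exact: meetF.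
rewrite meetUr leU2 //.
  by apply: le_trans cxy; rewrite leI2 ?leIl.
by apply: le_trans exy; rewrite leI2 ?leIr.
Qed.

Lemma filter_himp_himp x y x' y' : F (himp y x) -> F (himp x' y') ->
  F (himp (himp x x') (himp y y')).
Proof.
have [_ _ meetF] := LF.
move=> /filter_himpP[c Fc cyx] /filter_himpP[e Fe exy]; apply/filter_himpP.
exists (e `&` c); first exact: meetF.
rewrite le_himp; apply: le_trans exy.
rewrite -!meetA leI2 // meetCA.
by apply: le_trans (leI2 (lexx _) cyx) _; rewrite meetC meet_himp leIr.
Qed.

End FilterRelation.

Lemma filter_rel_congruence F : regular_filter F ->
  @congruence _ (gsim_algebra T) (filter_rel F).
Proof.
move=> [LF dF]; have [_ upF _] := LF.
(* Regularity is used here: [F] contains [delta (himp x y)], which lies below the required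
   implication. *)
have simF x y : F (himp x y) -> F (himp (sim y) (sim x)).
  by move=> /dF; apply: upF; exact: delta_himp_sim.
split.
- by move=> x; split; exact: filter_himp_refl.
- by move=> x y [].
- move=> x y z [xy yx] [yz zy].
  by split; exact: (filter_himp_trans LF (y := y)).
- case=> u v uv /=.
  + by split; apply: filter_himpU => //; apply uv.
  + by split; apply: filter_himpI => //; apply uv.
  + by split; apply: filter_himp_himp => //; apply uv.
  + by split; apply: simF; apply uv.
  + by split; exact: filter_himp_refl.
  + by split; exact: filter_himp_refl.
Qed.

Definition top_class (R : set (T * T)) : set T := [set x | R (x, \top)]%classic.

Lemma filter_relK F : lattice_filter F -> top_class (filter_rel F) = F.
Proof.
move=> LF; have [_ upF _] := LF.
have impT x : himp x \top = \top by apply/himp_top; exact: lex1.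
have Timp x : himp \top x = x by rewrite -[LHS]meet1x meet_himp meet1x.
apply/seteqP; split=> x; first by case=> _ /=; rewrite Timp.
by move=> Fx; split; rewrite /= ?Timp // impT; exact: filter_top LF.
Qed.

Section CongruenceTopClass.
Variable R : set (T * T).
Hypothesis RC : @congruence _ (gsim_algebra T) R.

Let rR : forall x, R (x, x). Proof. by case: RC. Qed.
Let sR : forall x y, R (x, y) -> R (y, x). Proof. by case: RC. Qed.
Let tR : forall x y z, R (x, y) -> R (y, z) -> R (x, z). Proof. by case: RC. Qed.

Lemma congruence_gsim_op (g : gsim_symbol) (u v : 'I_(gsim_arity g) -> T) :
  (forall i, R (u i, v i)) -> R (gsim_op u, gsim_op v).
Proof. by case: RC => _ _ _ cR; exact: (cR g). Qed.

(** Argument list of a binary symbol; the operation applied to it computes to the operation on [x]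
    and [y]. *)
Let pair2 x y (i : 'I_2) : T := if i == ord0 then x else y.

Let pair2R x x' y y' : R (x, x') -> R (y, y') ->
  forall i, R (pair2 x y i, pair2 x' y' i).
Proof. by rewrite /pair2 => xx yy i; case: ifP. Qed.

Lemma congruence_meet x x' y y' : R (x, x') -> R (y, y') ->
  R (x `&` y, x' `&` y').
Proof. by move=> xx yy; exact: (@congruence_gsim_op Smeet _ _ (pair2R xx yy)). Qed.

Lemma congruence_join x x' y y' : R (x, x') -> R (y, y') ->
  R (x `|` y, x' `|` y').
Proof. by move=> xx yy; exact: (@congruence_gsim_op Sjoin _ _ (pair2R xx yy)). Qed.

Lemma congruence_himp x x' y y' : R (x, x') -> R (y, y') ->
  R (himp x y, himp x' y').
Proof. by move=> xx yy; exact: (@congruence_gsim_op Simp _ _ (pair2R xx yy)). Qed.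

Lemma congruence_sim x x' : R (x, x') -> R (sim x, sim x').
Proof.
by move=> xx; exact: (@congruence_gsim_op Ssim (fun=> x) (fun=> x') (fun=> xx)).
Qed.

Lemma regular_filter_top_class : regular_filter (top_class R).
Proof.
split; first split.
- by exists \top; exact: rR.
- move=> x y xy xT; have := congruence_join xT (rR y).
  by rewrite (join_idPr xy) join1x.
- by move=> x y xT yT; have := congruence_meet xT yT; rewrite meet1x.
(* Once 1 is written as [delta \top], both sides have the form [himp (sim _) \bot]. *)
- move=> x xT; rewrite /top_class /= -delta1.
  exact: (congruence_himp (congruence_sim xT) (rR \bot)).
Qed.

Lemma top_classK : filter_rel (top_class R) = R.
Proof.
apply/seteqP; split=> -[x y] /=.
  move=> [/= xyT yxT].
  (* Both [x] and [y] are then related to their meet. *)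
  have h u v : R (himp u v, \top) -> R (u `&` v, u).
    by move=> /(congruence_meet (rR u)); rewrite meet_himp meetx1.
  by apply: tR (sR (h _ _ xyT)) _; rewrite meetC; exact: h.
move=> xy; split=> /=; rewrite /top_class /=.
  by rewrite -(himp_refl y); exact: congruence_himp xy (rR y).
by rewrite -(himp_refl x); exact: congruence_himp (sR xy) (rR x).
Qed.

Lemma top_class1_eq : (forall x, R (x, \top) -> x = \top) ->
  R = [set xy | xy.1 = xy.2]%classic.
Proof.
move=> R1; apply/seteqP; split=> -[x y]; last by move=> /= ->; exact: rR.
rewrite -{1}top_classK => -[/R1/himp_top xy /R1/himp_top yx].
by apply/le_anti/andP.
Qed.

Lemma top_class0_setT : R (\bot, \top) -> R = setT.
Proof.
move=> R0; apply/seteqP; split=> // -[x y] _.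
have R0x z : R (\bot, z).
  by have := congruence_meet R0 (rR z); rewrite meet0x meet1x.
exact: tR (sR (R0x x)) (R0x y).
Qed.

End CongruenceTopClass.

(** * Principal filters, chains and simplicity *)

(** Both implications between [x] and [y] lie above [b] and [c], hence above their join 1. *)
Lemma filter_rel_up_join b c x y : b `|` c = \top ->
  filter_rel [set z | b <= z]%classic (x, y) ->
  filter_rel [set z | c <= z]%classic (x, y) -> x = y.
Proof.
move=> bc [/= bxy byx] [/= cxy cyx].
by apply/le_anti/andP; split; apply/himp_top/eqP; rewrite -le1x -bc leUx;
  apply/andP.
Qed.

Lemma total_simple : total (fun x y : T => x <= y) -> simple (gsim_algebra T).
Proof.
move=> tot [R RC] /=.
have [R0|nR0] := pselect (R (\bot, \top)).
  by right; exact: (top_class0_setT RC).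
left; apply: (top_class1_eq RC) => x xT.
have [_ dF] := regular_filter_top_class RC.
by case: (delta_total x tot) => // d0; case: nR0; rewrite -d0; exact: dF.
Qed.

Lemma regular_filter_up_delta b :
  regular_filter [set z | delta b <= z]%classic.
Proof.
split=> [|x /= bx]; first exact: lattice_filter_up.
by rewrite -delta_idem; exact: le_delta.
Qed.

Lemma filter_rel_up_diagonal b :
  (forall x y, filter_rel [set z | b <= z]%classic (x, y) -> x = y) ->
  b = \top.
Proof.
(* The pair to test is [(b, \top)]: [b] is congruent to 1 modulo its own principal filter. *)
move=> diag; apply: diag; split=> /=; last by rewrite le_himp leIl.
by have /himp_top-> := lex1 b; exact: lex1.
Qed.

Lemma delta_himp_join x y : delta (himp x y) `|` delta (himp y x) = \top.
Proof. by rewrite -deltaU himp_prelinear delta1. Qed.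

Lemma delta_himp_top x y : delta (himp x y) = \top -> x <= y.
Proof. by move=> e; apply/himp_top/eqP; rewrite -le1x -e delta_le. Qed.

Lemma subdirectly_irreducible_total :
  subdirectly_irreducible (gsim_algebra T) -> total (fun x y : T => x <= y).
Proof.
move=> siT x y.
have Rup z : @congruence _ (gsim_algebra T) _ :=
  filter_rel_congruence (regular_filter_up_delta z).
case: (subdirectly_irreducible_meet siT (Rup (himp x y)) (Rup (himp y x))).
- by move=> u v; apply: filter_rel_up_join; exact: delta_himp_join.
- by move=> /filter_rel_up_diagonal/delta_himp_top ->.
- by move=> /filter_rel_up_diagonal/delta_himp_top ->; rewrite orbT.
Qed.

Lemma congruences_regular_filters_isomorphic :
  lattice_isomorphic (closed_set (regular_filters T))
                     (closed_set (Con (gsim_algebra T))).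
Proof.
apply: (@closed_set_lattice_isomorphic _ _ (regular_filters T)
          (Con (gsim_algebra T)) (@filter_rel) (@top_class)).
- exact: filter_rel_congruence.
- exact: regular_filter_top_class.
- by move=> F [LF _]; exact: filter_relK.
- exact: top_classK.
- by move=> F G FG [x y] [/FG xy /FG yx].
- by move=> R Q RQ x /RQ.
Qed.

End Gsim.

(** * Quantifiers and monadic regular filters *)

Section MGsim.
Variables (d : Order.disp_t) (A : mgsimType d).
Implicit Types (x y z b : A) (F : set A) (R : set (A * A)).

Lemma qall_homo x y : x <= y -> qall x <= qall y.
Proof.
(* By (M3) the implication between the quantified elements is [qall (himp (qall x) y)]. *)
move=> xy; apply/himp_top; rewrite -axM3.
suff -> : himp (qall x) y = \top by exact: qall1.
by apply/himp_top/(le_trans _ xy)/qall_le.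
Qed.

Lemma qall_range x : x \in range (@qex d A) -> qall x = x.
Proof. by move=> /range_qexP <-; exact: qall_qex. Qed.

(** The right side lies in the range of [qex], so [qall] fixes it; being below the meet of [x] and
    [y], it stays below after [qall]. *)
Lemma qallI x y : qall (x `&` y) = qall x `&` qall y.
Proof.
apply/le_anti; rewrite lexI !qall_homo ?leIl ?leIr //=.
rewrite -[leLHS]qall_range; last by apply: range_qex_meet; exact: mem_qall.
by apply: qall_homo; rewrite leI2 ?qall_le.
Qed.

Lemma qexE x : qex x = sim (qall (sim x)).
Proof. by rewrite axQ !simK. Qed.

Lemma range_qex_delta x : x \in range (@qex d A) ->
  delta x \in range (@qex d A).
Proof.
by move=> xE; apply: range_qex_himp; [exact: range_qex_sim|exact: range_qex_bot].
Qed.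

Lemma congruence_reduct R : @congruence _ (mgsim_algebra A) R ->
  @congruence _ (gsim_algebra A) R.
Proof. by case=> rR sR tR cR; split=> // g; exact: (cR (Sgsim g)). Qed.

Lemma filter_rel_monadic_congruence F : monadic_regular_filter F ->
  @congruence _ (mgsim_algebra A) (filter_rel F).
Proof.
move=> [LF dqF]; have [_ upF _] := LF.
have RC : @congruence _ (gsim_algebra A) (filter_rel F).
  by apply: filter_rel_congruence; split=> // x /dqF[].
have [rR sR tR cR] := RC.
(* As [qall] preserves meets and order, [qall (himp x y)] lies below [himp (qall x) (qall y)]. *)
have qF x y : F (himp x y) -> F (himp (qall x) (qall y)).
  move=> /dqF[_]; apply: upF; rewrite le_himp -qallI.
  by apply: qall_homo; rewrite -le_himp.
have qR x y : filter_rel F (x, y) -> filter_rel F (qall x, qall y).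
  by case=> /qF xy /qF yx.
split=> //; case=> [g||] u v uv; first exact: (cR g).
(* Compatibility with [qex] reduces to that with [sim] and [qall]. *)
- rewrite /= !qexE.
  by apply: (congruence_sim RC); apply: qR; apply: (congruence_sim RC).
- exact: qR.
Qed.

Lemma monadic_regular_filter_top_class R :
  @congruence _ (mgsim_algebra A) R -> monadic_regular_filter (top_class R).
Proof.
move=> RC; have [LF dF] := regular_filter_top_class (congruence_reduct RC).
split=> // x xT; split; first exact: dF.
have [_ _ _ cR] := RC.
have := cR Sall (fun=> x) (fun=> \top) (fun=> xT).
by rewrite /= qall1.
Qed.

Lemma congruences_monadic_regular_filters_isomorphic :
  lattice_isomorphic (closed_set (Con (mgsim_algebra A)))
                     (closed_set (monadic_regular_filters A)).
Proof.
apply: (@closed_set_lattice_isomorphic _ _ (Con (mgsim_algebra A))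
          (monadic_regular_filters A) (@top_class _ A) (@filter_rel _ A)).
- exact: monadic_regular_filter_top_class.
- exact: filter_rel_monadic_congruence.
- by move=> R /congruence_reduct; exact: top_classK.
- by move=> F [LF _]; exact: filter_relK.
- by move=> R Q RQ x /RQ.
- by move=> F G FG [x y] [/FG xy /FG yx].
Qed.

(** * Traces of filters on the subalgebra *)

Definition filter_trace F : set (exists_alg A) :=
  [set x : exists_alg A | F (exists_val x)]%classic.

Definition qall_alg x : exists_alg A := ExistsAlg (mem_qall x).

Definition filter_extension (G : set (exists_alg A)) : set A :=
  [set x | G (qall_alg x)]%classic.

Lemma regular_filter_trace F : monadic_regular_filter F ->
  regular_filter (filter_trace F).
Proof.
move=> [LF dqF]; have [_ upF meetF] := LF.
split; last by move=> x /dqF[].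
split=> [|x y xy|x y]; first by exists \top; exact: filter_top LF.
  exact: upF.
exact: meetF.
Qed.

Lemma monadic_regular_filter_extension (G : set (exists_alg A)) :
  regular_filter G -> monadic_regular_filter (filter_extension G).
Proof.
move=> [LG dG]; have [_ upG meetG] := LG.
split; first split.
- exists \top; rewrite /filter_extension /=.
  suff -> : qall_alg \top = \top by exact: filter_top LG.
  by apply: exists_val_inj; exact: qall1.
- by move=> x y xy; apply: upG; rewrite -exists_val_le; exact: qall_homo.
- move=> x y Gx Gy; have := meetG _ _ Gx Gy; apply: upG.
  by rewrite -exists_val_le exists_valI /= qallI.
- move=> x Gx; split; last first.
    by apply: upG Gx; rewrite -exists_val_le /= (qall_range (mem_qall x)).
  (* What remains is that [delta (qall x)] is below [qall (delta x)]: the former is fixed by [qall]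
     and lies below [delta x]. *)
  apply: upG (dG _ Gx); rewrite -exists_val_le.
  have -> : exists_val (delta (qall_alg x)) = delta (qall x) by [].
  rewrite -[leLHS]qall_range; last exact/range_qex_delta/mem_qall.
  by apply/qall_homo/le_delta/qall_le.
Qed.

Lemma monadic_regular_filters_regular_filters_isomorphic :
  lattice_isomorphic (closed_set (monadic_regular_filters A))
                     (closed_set (regular_filters (exists_alg A))).
Proof.
apply: (@closed_set_lattice_isomorphic _ _ (monadic_regular_filters A)
          (regular_filters (exists_alg A)) filter_trace filter_extension).
- exact: regular_filter_trace.
- exact: monadic_regular_filter_extension.
- move=> F [[_ upF _] dqF]; apply/seteqP; split=> x.
    by apply: upF; exact: qall_le.
  by move=> /dqF[].
- move=> G _; apply/funext => x; congr G; apply: exists_val_inj.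
  exact/qall_range/exists_valP.
- by move=> F G FG x /FG.
- by move=> F G FG x /FG.
Qed.

(** * Simplicity of the algebra and order of the subalgebra *)

Lemma subdirectly_irreducible_exists_total :
  subdirectly_irreducible (mgsim_algebra A) ->
  total (fun x y : exists_alg A => x <= y).
Proof.
move=> siA x y.
have Rup (u v : exists_alg A) : @congruence _ (mgsim_algebra A)
    (filter_rel [set z | delta (himp (exists_val u) (exists_val v)) <= z]%classic).
  apply: filter_rel_monadic_congruence.
  have [LF dF] := regular_filter_up_delta (himp (exists_val u) (exists_val v)).
  split=> // z bz; split; first exact: dF.
  (* The generator comes from the subalgebra, so [qall] fixes it and its principal filter is
     monadic. *)
  rewrite /= -[leLHS]qall_range; first exact: qall_homo.
  exact/range_qex_delta/range_qex_himp/exists_valP/exists_valP.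
case: (subdirectly_irreducible_meet siA (Rup x y) (Rup y x)).
- by move=> u v; apply: filter_rel_up_join; exact: delta_himp_join.
- by move=> /filter_rel_up_diagonal/delta_himp_top; rewrite exists_val_le => ->.
- move=> /filter_rel_up_diagonal/delta_himp_top; rewrite exists_val_le => ->.
  by rewrite orbT.
Qed.

(** [A] itself need not be a chain, so the dichotomy for [delta] is applied to [qall x]: either it
    is 1, forcing [x] to be 1, or its [delta] is 0 and 0 is related to 1. *)
Lemma exists_total_simple : total (fun x y : exists_alg A => x <= y) ->
  simple (mgsim_algebra A).
Proof.
move=> tot [R RC] /=; have RC' := congruence_reduct RC.
have [R0|nR0] := pselect (R (\bot, \top)).
  by right; exact: (top_class0_setT RC').
left; apply: (top_class1_eq RC') => x xT.
have [_ dqF] := monadic_regular_filter_top_class RC.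
have [_ qxT] := dqF _ xT; have [dqxT _] := dqF _ qxT.
case: (delta_total (qall_alg x) tot) => /(congr1 (@exists_val d A)) /= e.
  by apply/eqP; rewrite -le1x -[leLHS]e qall_le.
by case: nR0; rewrite -[\bot]e.
Qed.

End MGsim.

Theorem corollary2p5 (d : Order.disp_t) (A : mgsimType d) :
  (lattice_isomorphic (closed_set (Con (mgsim_algebra A)))
                      (closed_set (monadic_regular_filters A)) /\
   lattice_isomorphic (closed_set (monadic_regular_filters A))
                      (closed_set (regular_filters (exists_alg A))) /\
   lattice_isomorphic (closed_set (regular_filters (exists_alg A)))
                      (closed_set (Con (gsim_algebra (exists_alg A)))))
  /\
  [<-> subdirectly_irreducible (mgsim_algebra A);
       simple (mgsim_algebra A);
       subdirectly_irreducible (gsim_algebra (exists_alg A));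
       simple (gsim_algebra (exists_alg A));
       total (fun x y : exists_alg A => (x <= y)%O)].
Proof.
split.
  split; first exact: congruences_monadic_regular_filters_isomorphic.
  split; first exact: monadic_regular_filters_regular_filters_isomorphic.
  exact: congruences_regular_filters_isomorphic.
(* Each implication of the cycle passes through the total order of the subalgebra. *)
tfae.
- by move=> /subdirectly_irreducible_exists_total/exists_total_simple.
- move=> /simple_subdirectly_irreducible/subdirectly_irreducible_exists_total.
  by move=> /total_simple/simple_subdirectly_irreducible.
- by move=> /subdirectly_irreducible_total/total_simple.
- by move=> /simple_subdirectly_irreducible/subdirectly_irreducible_total.
- by move=> /exists_total_simple/simple_subdirectly_irreducible.
Qed.
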